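(* Let $Z$ be a continuous process on $[0,1]$, associated with the SDE $dZ_t=\sigma(Z_t)\,dW_t$, with $\sigma(0)=0$. The following three conditions cannot hold simultaneously: (a) Startability: $\mathbb{P}(Z_t>0)>0$ for some $t>0$ when $Z_0=0$. (b) Bounded domain: $Z_t\ge0$ for all $t\ge0$. (c) Martingale property: $\mathbb{E}[Z_t]=Z_0=0$ for all $t\ge0$. Consequently, within the class of processes satisfying (b) and (c), the only admissible boundary behaviour at $0$ is absorption: $Z_t=0$ for all $t\ge\tau_0$ on $\{\tau_0<\infty\}$.
   Context: $W$ is a standard Brownian motion, and $\tau_0=\inf\{t>0:Z_t=0\}$ is the first hitting time of $0$. Statements about paths are understood almost surely. *)

(* Defs.v *)
From HB Require Import structures.
From mathcomp Require Import all_boot all_order all_algebra.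
From mathcomp Require Import all_classical all_reals all_analysis.

Set Implicit Arguments.
Unset Strict Implicit.
Unset Printing Implicit Defensive.

Import Order.TTheory GRing.Theory Num.Theory.
Import numFieldNormedType.Exports.

Local Open Scope classical_set_scope.
Local Open Scope ring_scope.

(* Processes are functions R -> Om -> R, looked at only on a time set
   I : set R, in practice `[0, 1] or `[0, +oo[. *)
Section processes.
Context (d : measure_display) (Om : measurableType d) (R : realType).
Context (P : probability Om R).
Implicit Types (I : set R) (F : R -> set (set Om)) (G : set (set Om)).
Implicit Types (W X Z : R -> Om -> R) (f : Om -> R).

(* No completeness or right-continuity is assumed. *)
Definition filtration I F : Prop :=
  [/\ forall t, I t -> sigma_algebra setT (F t),
      forall t, I t -> F t `<=` measurable &
      forall s t, I s -> I t -> s <= t -> F s `<=` F t].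

Definition measurable_wrt G f : Prop :=
  forall B : set R, measurable B -> G (f @^-1` B).

Definition adapted I F X : Prop :=
  forall t, I t -> measurable_wrt (F t) (X t).

Definition continuous_process I X : Prop :=
  {ae P, forall w, {within I, continuous (fun t => X t w)}}.

Definition independent_of G f : Prop :=
  forall (A : set Om) (B : set R), G A -> measurable B ->
    P (A `&` f @^-1` B) = (P A * P (f @^-1` B))%E.

(* The second parameter of normal_prob is the standard deviation. *)
Definition brownian_motion I F W : Prop :=
  [/\ {ae P, forall w, W 0 w = 0},
      adapted I F W,
      continuous_process I W,
      forall s t, I s -> I t -> s < t ->
        independent_of (F s) (fun w => W t w - W s w) &
      forall s t, I s -> I t -> s < t -> forall B : set R, measurable B ->
        P ((fun w => W t w - W s w) @^-1` B) =
        normal_prob 0 (Num.sqrt (t - s)) B].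

(* H_s = \sum_(i < n) xi_i 1_{]t_i, t_(i+1)]}(s), with xi_i bounded and
   F_(t_i)-measurable. *)
Record simple_process I F := SimpleProcess {
  sp_size : nat ;
  sp_time : nat -> R ;
  sp_coef : nat -> Om -> R ;
  sp_timeI : forall i, I (sp_time i) ;
  sp_time_le : forall i, sp_time i <= sp_time i.+1 ;
  sp_coef_meas : forall i, measurable_wrt (F (sp_time i)) (sp_coef i) ;
  sp_coef_bnd : forall i, exists M : R, forall w, `|sp_coef i w| <= M }.

Definition sp_fun I F (H : simple_process I F) : R -> Om -> R := fun s w =>
  \sum_(i < sp_size H)
    sp_coef H i w * \1_(`]sp_time H i, sp_time H i.+1]) s.

Definition sp_integral I F (H : simple_process I F) W : R -> Om -> R :=
  fun t w => \sum_(i < sp_size H)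
    sp_coef H i w *
    (W (Num.min (sp_time H i.+1) t) w - W (Num.min (sp_time H i) t) w).

(* Convergence to 0 in probability of nonnegative variables.  The events E n
   stand for the outer probability, so that Y n may be measurable only up to
   null sets. *)
Definition cvg0_in_probability (Y : nat -> Om -> \bar R) : Prop :=
  forall e : R, 0 < e -> exists E : nat -> set Om,
    [/\ forall n, measurable (E n),
        forall n, [set w | (e%:E < Y n w)%E] `<=` E n &
        (fun n => P (E n)) @ \oo --> 0%E].

(* J is the Ito integral of X against W over [0, t]. *)
Definition is_ito_integral I F W X (t : R) (J : Om -> R) : Prop :=
  exists H : nat -> simple_process I F,
    cvg0_in_probability (fun n w =>
      \int[lebesgue_measure]_(s in `[0%R, t])
        ((sp_fun (H n) s w - X s w) ^+ 2)%:E)%E /\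
    cvg0_in_probability (fun n w => `|sp_integral (H n) W t w - J w|%:E).

(* dZ_t = sigma(Z_t) dW_t, i.e. Z_t = Z_0 + int_0^t sigma(Z_s) dW_s a.s. *)
Definition sde_solution I F W (sigma : R -> R) Z : Prop :=
  [/\ filtration I F, brownian_motion I F W, adapted I F Z,
      continuous_process I Z &
      forall t, I t ->
        {ae P, forall w, (\int[lebesgue_measure]_(s in `[0%R, t])
           ((sigma (Z s w)) ^+ 2)%:E < +oo)%E} /\
        is_ito_integral I F W (fun s w => sigma (Z s w)) t
          (fun w => Z t w - Z 0 w)].

Definition starts_at_zero Z : Prop := {ae P, forall w, Z 0 w = 0}.

Definition startable I Z : Prop :=
  starts_at_zero Z /\
  exists t, [/\ I t, 0 < t & (0 < P [set w | (0 < Z t w)%R])%E].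

Definition nonnegative_process I Z : Prop :=
  {ae P, forall w, forall t, I t -> 0 <= Z t w}.

Definition zero_mean I Z : Prop :=
  starts_at_zero Z /\ forall t, I t -> ('E_P[Z t] = 0)%E.

(* E[Z_t | F_s] = Z_s, conditional expectation being characterised by its
   integrals over the events of F_s. *)
Definition martingale I F Z : Prop :=
  [/\ adapted I F Z,
      forall t, I t -> P.-integrable setT (EFin \o Z t) &
      forall s t, I s -> I t -> s <= t -> forall A, F s A ->
        (\int[P]_(w in A) (Z t w)%:E = \int[P]_(w in A) (Z s w)%:E)%E].

(* +oo if there is no such time *)
Definition hitting_time0 I Z (w : Om) : \bar R :=
  ereal_inf [set t%:E | t in [set t | [/\ I t, 0 < t & Z t w = 0]]].

Definition absorbed_at_zero I Z : Prop :=
  {ae P, forall w, (hitting_time0 I Z w < +oo)%E ->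
    forall t, I t -> (hitting_time0 I Z w <= t%:E)%E -> Z t w = 0}.

End processes.

(* Main.v *)
Require Import Defs.
From HB Require Import structures.
From mathcomp Require Import all_boot all_order all_algebra.
From mathcomp Require Import all_classical all_reals all_analysis.
From mathcomp Require Import measurable_realfun.

(** The argument is measure-theoretic: it rests on the sign of [Z], the
    continuity of its paths, and its mean or martingale property.

    If [Z] is nonnegative with mean zero, then [Z t] vanishes almost surely for
    each fixed [t], being a nonnegative variable with integral zero
    ([zero_mean_eq0]).  This rules out startability.

    For a nonnegative martingale, absorption is a maximal inequality.  Whenever
    [Z] has gone below [e] at one of finitely many times before [T], the
    martingale property says that the mean of [Z T] on that event is still at
    most [e]: split the event according to the first such time, and replace
    [Z T] by the value at that time ([martingale_maximal_sorted]).  The bound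
    does not depend on the times, so it passes to a countable dense set of
    times, and letting [e] tend to 0 gives that [Z T] vanishes almost surely on
    the event that [Z] comes arbitrarily close to 0 at those times.  By
    continuity this event contains every path with a zero before [T]
    ([martingale_zero_before]).  Since the first passage is taken over
    deterministic finite sets of times, the hitting time need not be a stopping
    time, and the filtration may be arbitrary.

    In both situations it remains to go from each fixed time to all times at
    once, through rational times and continuity
    ([absorbed_of_fixed_times]). *)

Set Implicit Arguments.
Unset Strict Implicit.
Unset Printing Implicit Defensive.

Import Order.TTheory GRing.Theory Num.Theory.
Import numFieldNormedType.Exports.

Local Open Scope classical_set_scope.
Local Open Scope ring_scope.

(** * Continuous paths and rational times *)

Lemma within_continuous_dist (R : realType) (I : set R) (z : R -> R) (t e : R) :
  {within I, continuous z} -> I t -> 0 < e ->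
  exists2 r : R, 0 < r & forall u, I u -> `|u - t| < r -> `|z u - z t| < e.
Proof.
move=> /subspace_continuousP cz It e0.
have /cvgrPdist_lt /(_ e e0) := cz t It.
rewrite near_withinE /= => -[r /= r0 zr]; exists r => // u Iu ur.
by rewrite distrC; apply: zr => //=; rewrite distrC.
Qed.

Lemma within_continuous_eq0 (R : realType) (I : set R) (z : R -> R) (t : R) :
  {within I, continuous z} -> I t ->
  (forall r : R, 0 < r -> exists u, [/\ I u, `|u - t| < r & z u = 0]) ->
  z t = 0.
Proof.
move=> cz It zeros; apply/eqP/negP => /negP; rewrite -normr_gt0 => zt0.
have [r r0 zr] := within_continuous_dist cz It zt0.
have [u [Iu ur zu0]] := zeros r r0.
by have := zr u Iu ur; rewrite zu0 sub0r normrN ltxx.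
Qed.

(** The nonnegative rationals as a sequence, so that countable families of
    times can be cut into finite, increasing ones. *)
Definition rat_time (R : realType) (k : nat) : R :=
  `|ratr (odflt 0%Q (unpickle k : option rat))|.

Lemma rat_time_ge0 (R : realType) k : 0 <= rat_time R k.
Proof. exact: normr_ge0. Qed.

Lemma rat_time_dense (R : realType) (a b : R) : 0 <= a -> a < b ->
  exists k, a < rat_time R k < b.
Proof.
move=> a0 /rat_in_itvoo[q]; rewrite in_itv/= => /andP[aq qb].
exists (pickle q); rewrite /rat_time pickleK /= ger0_norm ?aq//.
exact: ltW (le_lt_trans a0 aq).
Qed.

(** * The maximal inequality *)

Lemma sigma_algebra_setI T (G : set (set T)) A B :
  sigma_algebra setT G -> G A -> G B -> G (A `&` B).
Proof.
move=> sG GA GB.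
have [G0 GC GU] := sG.
rewrite -(setCK (A `&` B)) setCI -!setTD; apply: (GC).
rewrite -bigcup2E; apply: GU => -[|[|n]] //=; exact: GC.
Qed.

Section processes.
Context (d : measure_display) (Om : measurableType d) (R : realType).
Context (P : probability Om R).
Implicit Types (I : set R) (F : R -> set (set Om)) (Z : R -> Om -> R).

Lemma adapted_measurable I F Z t :
  filtration I F -> adapted I F Z -> I t -> measurable_fun setT (Z t).
Proof.
move=> [_ Fm _] aZ It _ B mB; rewrite setTI; exact: Fm (aZ t It B mB).
Qed.

Definition visits_below Z (e : R) (s : seq R) : set Om :=
  [set w | has (fun u => Z u w < e) s].

Lemma visits_belowP Z e s w :
  visits_below Z e s w <-> exists2 u, u \in s & Z u w < e.
Proof. by split=> [/hasP|?]; last apply/hasP. Qed.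

Lemma visits_below_nil Z e : visits_below Z e [::] = set0.
Proof. by apply/seteqP; split. Qed.

Lemma visits_below_measurable Z e s :
  (forall u, u \in s -> measurable_fun setT (Z u)) ->
  measurable (visits_below Z e s).
Proof.
elim: s => [_|u s IHs mZ]; first by rewrite visits_below_nil.
have -> : visits_below Z e (u :: s) =
    Z u @^-1` `]-oo, e[ `|` visits_below Z e s.
  by apply/seteqP; split=> w; rewrite /visits_below /= in_itv/= => /orP.
apply: measurableU.
  by rewrite -[X in measurable X]setTI; apply: mZ => //; rewrite inE eqxx.
by apply: IHs => v vs; apply: mZ; rewrite inE vs orbT.
Qed.

(** Induction on the times: on the part of [G] where [Z] is below [e] at the
    first time [u], [Z T] has the same integral as [Z u]; the rest of [G] is an
    event of [F u], to which the induction hypothesis applies.  This is why a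
    set [G] of the past has to be carried along. *)
Lemma martingale_maximal_sorted I F Z (T e : R) (a : R) (s : seq R)
    (G : set Om) :
  filtration I F -> martingale P I F Z -> I T ->
  (forall u, u \in s -> I u /\ u <= T) -> path <=%R a s -> I a -> F a G ->
  (\int[P]_(w in G `&` visits_below Z e s) (Z T w)%:E
     <= e%:E * P (G `&` visits_below Z e s))%E.
Proof.
move=> fF mZ IT; have [sF Fm Fle] := fF; have [aZ iZ eZ] := mZ.
elim: s a G => [a G _ _ _ _|u s IHs a G sI /= /andP[au us] Ia FaG].
  by rewrite visits_below_nil setI0 integral_set0 measure0 mule0.
have [Iu uT] : I u /\ u <= T by apply: sI; rewrite inE eqxx.
have {}FaG : F u G by exact: Fle Ia Iu au G FaG.
pose L := Z u @^-1` `]-oo, e[.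
have FuL : F u L by exact: aZ.
have FuGL : F u (G `&` L) by exact: (sigma_algebra_setI (sF u Iu)).
have FuGLC : F u (G `&` ~` L).
  apply: (sigma_algebra_setI (sF u Iu)) => //.
  by case: (sF u Iu) => _ /(_ L FuL); rewrite setTD.
have sI' v : v \in s -> I v /\ v <= T.
  by move=> vs; apply: sI; rewrite inE vs orbT.
have -> : G `&` visits_below Z e (u :: s) =
    (G `&` L) `|` ((G `&` ~` L) `&` visits_below Z e s).
  apply/seteqP; split=> w; rewrite /visits_below /L /= in_itv/=.
    move=> [Gw /orP[?|?]]; first by left.
    by case: (boolP (Z u w < e)) => [?|/negP ?]; [left|right].
  by case=> [[Gw ->]//|[[Gw _] ->]]; rewrite orbT.
set B := (G `&` ~` L) `&` _.
have mGL : measurable (G `&` L) by exact: Fm FuGL.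
have mB : measurable B.
  apply: measurableI; first exact: Fm FuGLC.
  apply: visits_below_measurable => v /sI'[Iv _].
  exact: adapted_measurable fF aZ Iv.
have dGLB : [disjoint G `&` L & B].
  by apply/disj_setPS => w [[_ Lw] [[_ nLw] _]].
have mZT : measurable_fun setT (Z T) by exact: adapted_measurable fF aZ IT.
rewrite (@integral_setU _ _ _ P _ _ (EFin \o Z T))//; last first.
  by apply/measurable_EFinP; exact: measurable_funTS.
rewrite measureU//; last exact/eqP/dGLB.
rewrite ge0_muleDr//; apply: leeD.
  rewrite (eZ u T Iu IT uT _ FuGL) -integral_cst//.
  apply: le_integral => //.
  - by apply: integrableS (iZ u Iu).
  - exact: finite_measure_integrable_cst.
  - by move=> w; rewrite inE => -[_]; rewrite /L /= in_itv/= lee_fin => /ltW.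
exact: (IHs u _ sI' us Iu FuGLC).
Qed.

(** The event does not depend on the order of the times, hence they may be
    sorted.  The free order is what allows enumerating a dense set. *)
Lemma martingale_maximal_finite I F Z (T e : R) (s : seq R) :
  filtration I F -> martingale P I F Z -> I T -> 0 <= e ->
  (forall u, u \in s -> I u /\ u <= T) ->
  (\int[P]_(w in visits_below Z e s) (Z T w)%:E <= e%:E)%E.
Proof.
move=> fF mZ IT e0 sI; have [sF Fm Fle] := fF; have [aZ iZ eZ] := mZ.
have -> : visits_below Z e s = visits_below Z e (sort <=%R s).
  apply/seteqP; split=> w /=; rewrite /visits_below /=.
    by rewrite (eq_has_r (mem_sort _ _)).
  by rewrite (eq_has_r (mem_sort _ _)).
have {sI} : forall u, u \in sort <=%R s -> I u /\ u <= T.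
  by move=> u; rewrite mem_sort; exact: sI.
have := sort_le_sorted s.
case: (sort _ _) => [_ _|a r /= ar sI].
  by rewrite visits_below_nil integral_set0 lee_fin.
have Ia : I a by case: (sI a); rewrite ?inE ?eqxx.
have FaT : F a setT.
  by case: (sF a Ia) => F0 FC _; rewrite -(setD0 setT); exact: FC.
rewrite -(setTI (visits_below _ _ _)).
(* The first time itself bounds the list from below. *)
apply: le_trans (martingale_maximal_sorted e fF mZ IT sI _ Ia FaT) _.
  by rewrite /= lexx.
rewrite -[leRHS]mule1; apply: lee_wpmul2l; first by rewrite lee_fin.
apply: probability_le1; rewrite setTI.
apply: visits_below_measurable => v /sI[Iv _].
exact: adapted_measurable fF aZ Iv.
Qed.

(** * Absorption *)

(** The process comes arbitrarily close to 0 along a dense sequence of times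
    before [T] on each continuous path with a zero before [T]; the maximal
    inequality, which survives the passage to countably many times by monotone
    convergence, makes the integral of [`|Z T|] over that event zero. *)
Lemma martingale_zero_before I F Z (T : R) :
  (forall s t, I t -> 0 <= s -> s <= t -> I s) ->
  filtration I F -> martingale P I F Z -> nonnegative_process P I Z ->
  continuous_process P I Z -> I T -> 0 <= T ->
  {ae P, forall w, (exists s, [/\ 0 <= s, s <= T & Z s w = 0]) -> Z T w = 0}.
Proof.
move=> Idown fF mZ Z0 cZ IT T0; have [aZ _ _] := mZ.
(* Truncation at T preserves density in [0, T] and keeps all times in I. *)
pose q k : R := Num.min T (rat_time R k).
have qI k : I (q k) /\ q k <= T.
  have qT : q k <= T by rewrite /q ge_min lexx.
  by split=> //; apply: Idown IT _ qT; rewrite /q le_min T0 rat_time_ge0.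
have mI t : I t -> measurable_fun setT (Z t) by exact: adapted_measurable fF aZ.
pose B e n := visits_below Z e (mkseq q n).
have mB e n : measurable (B e n).
  by apply: visits_below_measurable => _ /mapP[k _ ->]; exact/mI/(qI k).1.
pose A e := \bigcup_n B e n.
have mA e : measurable (A e) by exact: bigcup_measurable.
have mZT D : measurable_fun D (EFin \o Z T).
  by apply/measurable_EFinP/measurable_funTS/mI.
have mabs D : measurable_fun D (abse \o (EFin \o Z T)).
  exact: measurableT_comp.
have intA e : 0 <= e -> (\int[P]_(w in A e) `|(Z T w)%:E| <= e%:E)%E.
  move=> e0.
  have ndB : {homo B e : n m / (n <= m)%N >-> (n <= m)%O}.
    move=> n m nm; apply/subsetPset => w /visits_belowP[u /mapP[k]].
    rewrite mem_iota /= => kn -> qe; apply/visits_belowP; exists (q k) => //.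
    by apply: map_f; rewrite mem_iota /=; exact: leq_trans nm.
  have cvgA := @ge0_nondecreasing_set_cvg_integral _ _ _ (B e)
    (abse \o (EFin \o Z T)) P ndB (mB e) (fun=> mabs _)
    (fun _ _ _ => abse_ge0 _).
  rewrite -(cvg_lim _ cvgA)//; apply: lime_le; first exact/cvgP/cvgA.
  apply: nearW => n.
  rewrite (_ : (\int[P]_(w in _) _)%E = (\int[P]_(w in B e n) (Z T w)%:E)%E).
    by apply: martingale_maximal_finite mZ _ _ _ => // _ /mapP[k _ ->].
  apply: ae_eq_integral => //.
  by apply: filterS Z0 => w Zw _ /=; rewrite ger0_norm// Zw.
pose A0 := \bigcap_m A m.+1%:R^-1.
have mA0 : measurable A0 by exact: bigcapT_measurable.
have int0 : (\int[P]_(w in A0) `|(Z T w)%:E| = 0)%E.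
  apply/eqP; rewrite eq_le integral_ge0 ?andbT//.
  apply/lee_addgt0Pr => e e0; rewrite add0e.
  have [m me] := @ltr_add_invr R 0 e e0; rewrite add0r in me.
  apply: le_trans (_ : m.+1%:R^-1%:E <= _)%E; last by rewrite lee_fin ltW.
  apply: le_trans (intA m.+1%:R^-1 _); last by rewrite invr_ge0.
  by apply: ge0_subset_integral => //; exact: bigcap_inf.
have /ae_eq_integral_abs-/(_ mA0 (mZT _)) ae0 := int0.
apply: filterS2 ae0 cZ => w /= Z0w cw [s [s0 sT Zs]].
suff A0w : A0 w by have [] := Z0w A0w.
move=> m _.
have m0 : 0 < m.+1%:R^-1 :> R by rewrite invr_gt0.
have [r r0 rZ] := within_continuous_dist cw (Idown _ _ IT s0 sT) m0.
(* The rational is taken to the right of s, so that when s = T it is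
   truncated to T itself. *)
have [k /andP[sk kr]] : exists k, s < rat_time R k < s + r.
  by apply: rat_time_dense => //; rewrite ltrDl.
exists k.+1 => //; apply/visits_belowP; exists (q k).
  by apply: map_f; rewrite mem_iota /=.
have sq : s <= q k by rewrite le_min sT ltW.
have := rZ (q k) (qI k).1.
rewrite Zs subr0 => /(_ _)/(le_lt_trans (ler_norm _)); apply.
by rewrite ger0_norm ?subr_ge0// ltrBlDl gt_min kr orbT.
Qed.

(** Once a zero [s] with [0 < s < t] is known, [Z] vanishes at the rationals
    between [s] and [t], hence at [t].  If there is none while the hitting time
    is at most [t], then it equals [t], and there are zeros in [`[t, t + r[] for
    every [r > 0]. *)
Lemma absorbed_of_fixed_times I Z :
  (forall s t, I t -> 0 <= s -> s <= t -> I s) ->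
  continuous_process P I Z ->
  (forall t, I t -> {ae P, forall w,
     (exists s, [/\ 0 <= s, s <= t & Z s w = 0]) -> Z t w = 0}) ->
  absorbed_at_zero P I Z.
Proof.
move=> Idown cZ Zfix.
have Zrat k : {ae P, forall w, I (rat_time R k) ->
    (exists s, [/\ 0 <= s, s <= rat_time R k & Z s w = 0]) ->
    Z (rat_time R k) w = 0}.
  have [Ik|nIk] := pselect (I (rat_time R k)); last by apply: aeW.
  by apply: filterS (Zfix _ Ik) => w Zw _.
apply: filterS2 cZ (ae_foralln Zrat) => w cw Zw _ t It taut.
have after s : 0 < s -> s < t -> Z s w = 0 -> Z t w = 0.
  move=> s0 st Zs; apply: (within_continuous_eq0 cw It) => r r0.
  have [||k] := @rat_time_dense R (Num.max s (t - r)) t.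
  - by rewrite le_max ltW.
  - by rewrite gt_max st ltrBlDr ltrDl.
  - rewrite gt_max => /andP[/andP[sk rk] kt].
    have Ik : I (rat_time R k) by exact: Idown It (rat_time_ge0 _ _) (ltW kt).
    exists (rat_time R k); split=> //.
      by rewrite distrC ger0_norm ?subr_ge0 ?ltW// ltrBlDr -ltrBlDl.
    by apply: Zw => //; exists s; split=> //; exact: ltW.
have [[s [s0 st Zs]]|no_zero] :=
    pselect (exists s, [/\ 0 < s, s < t & Z s w = 0]); first exact: after Zs.
apply: (within_continuous_eq0 cw It) => r r0.
have [_ [u [Iu u0 Zu] <-]] : exists2 y,
    [set u%:E | u in [set u | [/\ I u, 0 < u & Z u w = 0]]] y &
    (y < (t + r)%:E)%E.
  apply: ereal_inf_lt; apply: le_lt_trans taut _.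
  by rewrite lte_fin ltrDl.
rewrite lte_fin => ur; exists u; split=> //.
have tu : t <= u by rewrite leNgt; apply/negP => ut; apply: no_zero; exists u.
by rewrite ger0_norm ?subr_ge0// ltrBlDl.
Qed.

Lemma zero_mean_eq0 I F Z t :
  filtration I F -> adapted I F Z -> nonnegative_process P I Z ->
  zero_mean P I Z -> I t -> {ae P, forall w, Z t w = 0}.
Proof.
move=> fF aZ Z0 [_ EZ] It.
have mZ : measurable_fun setT (EFin \o Z t).
  by apply/measurable_EFinP; exact: adapted_measurable fF aZ It.
have int0 : (\int[P]_w `|(Z t w)%:E| = 0)%E.
  have := EZ t It; rewrite unlock => <-.
  apply: ae_eq_integral => //; first exact: measurableT_comp.
  by apply: filterS Z0 => w Zw _ /=; rewrite ger0_norm// Zw.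
have /ae_eq_integral_abs-/(_ measurableT mZ) := int0.
by apply: filterS => w /(_ Logic.I) [].
Qed.

End processes.

Theorem proposition1 (d : measure_display) (Om : measurableType d)
    (R : realType) (P : probability Om R)
    (I : set R) (F : R -> set (set Om)) (W Z : R -> Om -> R) (sigma : R -> R)
    (I_time : I = [set` `[0, 1]] \/ I = [set` `[0, +oo[])
    (sigma_meas : measurable_fun setT sigma) (sigma0 : sigma 0 = 0)
    (Z_sde : sde_solution P I F W sigma Z) :
  [/\ ~ [/\ startable P I Z, nonnegative_process P I Z & zero_mean P I Z],
      nonnegative_process P I Z -> zero_mean P I Z -> absorbed_at_zero P I Z &
      nonnegative_process P I Z -> martingale P I F Z ->
        absorbed_at_zero P I Z].
Proof.
have [fF _ aZ cZ _] := Z_sde.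
have Ige0 t : I t -> 0 <= t.
  by case: I_time => ->; rewrite /= in_itv/= => /andP[].
have Idown s t : I t -> 0 <= s -> s <= t -> I s.
  case: I_time => -> /=; rewrite !in_itv/= => /andP[_ t1] -> // st.
  exact: le_trans t1.
split.
- move=> [[_ [t [It t0 Pt]]] Z0 mZ].
  have Zt0 := zero_mean_eq0 fF aZ Z0 mZ It.
  suff PZ0 : P [set w | (0 < Z t w)%R] = 0%E by move: Pt; rewrite PZ0 ltxx.
  have mZt : measurable [set w | (0 < Z t w)%R].
    rewrite (_ : [set w | _] = setT `&` Z t @^-1` `]0, +oo[).
      exact: (adapted_measurable fF aZ It).
    by rewrite setTI; apply/seteqP; split=> w /=; rewrite in_itv/= andbT.
  apply/(negligibleP _ mZt); apply: negligibleS Zt0 => w /= Zw Zw0.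
  by rewrite Zw0 ltxx in Zw.
- move=> Z0 mZ; apply: absorbed_of_fixed_times => // t It.
  by apply: filterS (zero_mean_eq0 fF aZ Z0 mZ It).
- move=> Z0 mZ; apply: absorbed_of_fixed_times => // t It.
  exact: martingale_zero_before fF mZ Z0 cZ It (Ige0 _ It).
Qed.
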